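(* Fix an even integer $d\ge 2$. For integers $n\ge 1$ let $S_n=\langle a_1(n),a_2(n),a_3(n),a_4(n)\rangle\subseteq\mathbb{N}$ where $a_1(n)=4n^d-2n^{d/2}$, $a_2(n)=4n^d-1$, $a_3(n)=4n^d+2n^{d/2}$, $a_4(n)=4n^d+4n^{d/2}-1$. Then for every field $K$, $\beta_1(K[S_n])\ge 2n^{d/2}$.
   Context: $\langle a_1,\dots,a_4\rangle=\{\sum\lambda_ja_j:\lambda_j\in\mathbb{N}\}$. $\beta_1(K[S_n])$ is the minimal number of generators of the toric ideal $I_{S_n}$, i.e. the kernel of the $K$-algebra map $K[x_1,x_2,x_3,x_4]\to K[y]$ sending $x_j\mapsto y^{a_j(n)}$ (equivalently, the first Betti number of the semigroup algebra $K[S_n]$ in its minimal graded free resolution over $K[x_1,\dots,x_4]$ with $\deg x_j=a_j(n)$). *)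

(* Defs.v *)
From mathcomp Require Import all_boot all_algebra.
From mathcomp Require Import mpoly.
From mathcomp Require Import boolp.

Set Implicit Arguments.
Unset Strict Implicit.
Unset Printing Implicit Defensive.

Import GRing.Theory.
Local Open Scope ring_scope.

Section MinimalGenerators.
Variable R : comNzRingType.
Implicit Types (I : R -> Prop) (s : seq R).

Definition generates s I : Prop :=
  forall p : R,
    I p <-> exists c : 'I_(size s) -> R, p = \sum_(i < size s) c i * s`_i.

Definition generated_by_size I : pred nat :=
  fun m => `[< exists2 s, size s = m & generates s I >].

(* The default value 0 is only reached when I is not finitely generated; a positive
   lower bound on min_gens I therefore includes finite generation. *)
Definition min_gens I : nat :=
  if pselect (exists m, generated_by_size I m) is left ex then ex_minn ex
  else 0%N.

End MinimalGenerators.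

Section ToricIdeal.
Variables (K : fieldType) (r : nat) (a : 'I_r -> nat).

Definition toric_map (p : {mpoly K[r]}) : {poly K} :=
  mmap (@polyC K) (fun j => 'X^(a j)) p.

Definition toric_ideal (p : {mpoly K[r]}) : Prop := toric_map p = 0.

Definition beta1 : nat := min_gens toric_ideal.

End ToricIdeal.

(* The subtractions on nat are not truncated when 0 < n. *)
Definition gens (d n : nat) : 'I_4 -> nat :=
  tnth [tuple (4 * n ^ d - 2 * n ^ (d %/ 2))%N;
              (4 * n ^ d - 1)%N;
              (4 * n ^ d + 2 * n ^ (d %/ 2))%N;
              (4 * n ^ d + 4 * n ^ (d %/ 2) - 1)%N].

(* Main.v *)
(* Put k = 2 n^(d/2), so that the generators are k(k-1), (k-1)(k+1), k(k+1) and
   k(k+1) + (k-1).  For 0 <= i < k the monomials u_i = x3^(k-1-i) x4^i and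
   w_i = x1^(k+1-i) x2^i have the same weight, and every monomial of that weight
   other than u_i is prime to u_i.  Therefore "coefficient at u_i" vanishes on
   (x1, ..., x4) I, and the k functionals so obtained on I / (x1, ..., x4) I are
   dual to the binomials u_i - w_i; hence I needs at least k generators.

   That I is finitely generated is seen directly, without Hilbert's basis
   theorem: modulo the binomials x_j^(a_1) - x_1^(a_j) each monomial is congruent
   to x_1^q v with all exponents of v below a_1, and a binomial between two such
   monomials is a power of x_1 times a binomial of bounded degree. *)

Require Import Defs.
From mathcomp Require Import all_boot all_algebra.
From mathcomp Require Import mpoly zify ring.
From mathcomp Require Import boolp.

Import GRing.Theory.

(** * Minimal number of generators and linear combinations of a finite family *)

Section MinGens.
Set Implicit Arguments.
Unset Strict Implicit.
Local Open Scope ring_scope.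
Variable R : comNzRingType.
Implicit Types (I : R -> Prop) (s : seq R).

(** Finite generation rules out the default value 0 of [min_gens]. *)
Lemma leq_min_gens I (k : nat) :
  (exists s, generates s I) -> (forall s, generates s I -> (k <= size s)%N) ->
  (k <= min_gens I)%N.
Proof.
move=> [s0 gen_s0] lb; rewrite /min_gens; case: pselect => [ex|[]]; last first.
  by exists (size s0); apply/asboolP; exists s0.
by case: ex_minnP => m /asboolP[s <- /lb].
Qed.

Definition combination s (p : R) : Prop :=
  exists c : 'I_(size s) -> R, p = \sum_(i < size s) c i * s`_i.

Lemma combination0 s : combination s 0.
Proof. by exists (fun=> 0); rewrite big1 // => i _; rewrite mul0r. Qed.

Lemma combinationD s p q :
  combination s p -> combination s q -> combination s (p + q).
Proof.
move=> [c ->] [e ->]; exists (fun i => c i + e i).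
by rewrite -big_split; apply: eq_bigr => i _; rewrite mulrDl.
Qed.

Lemma combinationM s q p : combination s p -> combination s (q * p).
Proof.
move=> [c ->]; exists (fun i => q * c i).
by rewrite mulr_sumr; apply: eq_bigr => i _; rewrite mulrA.
Qed.

Lemma combination_mem s p : p \in s -> combination s p.
Proof.
move=> s_p; have lt_p : (index p s < size s)%N by rewrite index_mem.
exists (fun i => (i == Ordinal lt_p)%:R); rewrite (bigD1 (Ordinal lt_p)) //=.
rewrite eqxx mul1r nth_index // big1 ?addr0 // => i /negbTE ->.
by rewrite mul0r.
Qed.

Lemma combination_sum s (T : eqType) (r : seq T) (F : T -> R) :
  (forall i, i \in r -> combination s (F i)) ->
  combination s (\sum_(i <- r) F i).
Proof.
move=> sF; rewrite big_seq; elim/big_ind: _ => //.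
- exact: combination0.
- by move=> x y; apply: combinationD.
Qed.

End MinGens.

(** * Weights, toric ideals and isolated monomials *)

Section Toric.
Set Implicit Arguments.
Unset Strict Implicit.
Local Open Scope ring_scope.
Variables (K : fieldType) (r : nat) (a : 'I_r -> nat).
Implicit Types (p q f : {mpoly K[r]}) (u v w : 'X_{1..r}).

Definition weight u : nat := (\sum_i a i * u i)%N.

Lemma weightD u v : weight (u + v)%MM = (weight u + weight v)%N.
Proof.
by rewrite -big_split; apply: eq_bigr => i _; rewrite mnmDE mulnDr.
Qed.

Lemma weightMn u k : weight (u *+ k)%MM = (weight u * k)%N.
Proof.
by rewrite big_distrl; apply: eq_bigr => i _; rewrite mulmnE mulnA.
Qed.

Lemma weight1 i : weight U_(i)%MM = a i.
Proof.
rewrite /weight (bigD1 i) //= mnm1E eqxx muln1 big1 ?addn0 // => j /negbTE ne.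
by rewrite mnm1E eq_sym ne muln0.
Qed.

Lemma toric_mapX u : toric_map a 'X_[K, u] = 'X^(weight u).
Proof.
rewrite /toric_map mmapX /mmap1 -prodrXr.
by apply: eq_bigr => i _; rewrite exprM.
Qed.

Lemma toric_mapE p :
  toric_map a p = \sum_(u <- msupp p) p@_u *: 'X^(weight u).
Proof.
apply: eq_bigr => u _; rewrite -mul_polyC; congr (_ * _).
by rewrite -toric_mapX /toric_map mmapX.
Qed.

Lemma toric_idealM q p : toric_ideal a p -> toric_ideal a (q * p).
Proof. by rewrite /toric_ideal /toric_map rmorphM /= => ->; rewrite mulr0. Qed.

Lemma toric_idealD p q :
  toric_ideal a p -> toric_ideal a q -> toric_ideal a (p + q).
Proof.
by rewrite /toric_ideal /toric_map mmapD => -> ->; rewrite addr0.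
Qed.

Lemma toric_ideal_combination (s : seq {mpoly K[r]}) p :
  (forall q, q \in s -> toric_ideal a q) -> combination s p -> toric_ideal a p.
Proof.
move=> sI [c ->]; elim/big_ind: _; first exact: mmap0.
  by move=> *; apply: toric_idealD.
by move=> i _; apply: toric_idealM; apply: sI; apply: mem_nth.
Qed.

Lemma toric_ideal_binomial u v :
  weight u = weight v -> toric_ideal a ('X_[K, u] - 'X_[v]).
Proof.
move=> eq_w; rewrite /toric_ideal /toric_map mmapB.
by rewrite -/(toric_map a 'X_[u]) -/(toric_map a 'X_[v]) !toric_mapX eq_w subrr.
Qed.

(** Compare the coefficients of y^d in the image of [p]. *)
Lemma toric_ideal_sum_coeff p d :
  toric_ideal a p -> \sum_(u <- msupp p | weight u == d) p@_u = 0.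
Proof.
rewrite /toric_ideal toric_mapE => /(congr1 (fun P : {poly K} => P`_d)).
rewrite coef0 coef_sum => e; rewrite big_mkcond -[RHS]e.
apply: eq_bigr => u _; rewrite coefZ coefXn eq_sym.
by case: eqP; rewrite ?mulr1 ?mulr0.
Qed.

Lemma toric_ideal_coeff_eq0 p u :
  toric_ideal a p -> (forall v, weight v = weight u -> v = u) -> p@_u = 0.
Proof.
move=> /(@toric_ideal_sum_coeff p (weight u)) sum0 uniq_u; apply/eqP.
rewrite mcoeff_eq0; apply/negP => up; have := up; rewrite mcoeff_msupp.
move: sum0; rewrite big_mkcond (bigD1_seq u) ?msupp_uniq //= eqxx.
rewrite big1 ?addr0 => [->|v ne_v]; first by rewrite eqxx.
by case: eqP => // /uniq_u e; rewrite e eqxx in ne_v.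
Qed.

(** An isolated vertex of the graph on the monomials of a given weight in which monomials with a
    common variable are joined. *)
Definition isolated u : Prop :=
  forall v, weight v = weight u -> v <> u -> forall i, v i = 0%N \/ u i = 0%N.

(** If [w] has the weight of [u], then [w + v] and [u + v] have equal weight and share the variables
    of [v], so isolation forces them to coincide. *)
Lemma isolated_proper_factor u v :
  isolated (u + v)%MM -> v != 0%MM ->
  forall w, weight w = weight u -> w = u.
Proof.
move=> iso nz_v w eq_w; apply: (@addIm _ v); apply: contrapT => ne.
have {}iso := iso (w + v)%MM _ ne; apply/negP: nz_v; rewrite negbK.
apply/eqP/mnmP => i; rewrite mnm0E.
by case: (iso _ i); rewrite ?weightD ?eq_w // mnmDE; lia.
Qed.

(* A toric element has no coefficient at a proper divisor of an isolated
   monomial, so only the constant term of [q] contributes. *)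
Lemma mcoeffM_isolated q p u :
  toric_ideal a p -> isolated u -> (q * p)@_u = q@_0%MM * p@_u.
Proof.
move=> Ip iso; rewrite mcoeffM.
have lt0 : (mdeg (0%MM : 'X_{1..r}) < (mdeg u).+1)%N by rewrite mdeg0.
have ltu : (mdeg u < (mdeg u).+1)%N by [].
rewrite (bigD1 (BMultinom lt0, BMultinom ltu)) /= ?add0m //.
rewrite big1 ?addr0 // => -[[v lt_v] [w lt_w]] /= /andP[/eqP def_u ne].
rewrite (_ : p@_w = 0) ?mulr0 //; apply: toric_ideal_coeff_eq0 => //.
apply: (@isolated_proper_factor w v); first by rewrite addmC -def_u.
apply: contraNneq ne => v0; rewrite v0 add0m in def_u.
by apply/eqP; congr pair; apply: val_inj.
Qed.

(** Expanding each [f j] over [s] and reading coefficients at the [u i] factors the identity matrix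
    of size [k] through a space of dimension [size s]; only the constant terms of the cofactors
    enter. *)
Lemma isolated_leq_size (k : nat) (u : 'I_k -> 'X_{1..r})
    (f : 'I_k -> {mpoly K[r]}) (s : seq {mpoly K[r]}) :
  (forall i, isolated (u i)) -> (forall j, toric_ideal a (f j)) ->
  (forall i j, (f j)@_(u i) = (i == j)%:R) ->
  generates s (toric_ideal a) -> (k <= size s)%N.
Proof.
move=> iso If f_u gen_s.
have sI i : (i < size s)%N -> toric_ideal a s`_i.
  move=> lt_i; apply/gen_s; exact/combination_mem/mem_nth.
have /choice[c def_f] j := (gen_s _).1 (If j).
pose C := \matrix_(j < k, l < size s) (c j l)@_0%MM.
pose S := \matrix_(l < size s, i < k) (s`_l)@_(u i).
have CS : C *m S = 1%:M.
  apply/matrixP => j i; rewrite !mxE eq_sym -f_u def_f raddf_sum /=.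
  by apply: eq_bigr => l _; rewrite !mxE mcoeffM_isolated //; apply: sI.
rewrite -(mxrank1 K k) -CS; exact: leq_trans (mulmx_max_rank _ _) _.
Qed.

(** Replacing every monomial of [p] by a fixed one of the same weight gives 0, since the
    coefficients in each weight sum to 0. So [p] is a combination of the differences. *)
Lemma toric_ideal_binomial_span (s : seq {mpoly K[r]}) p :
  (forall u v, weight u = weight v -> combination s ('X_[K, u] - 'X_[v])) ->
  toric_ideal a p -> combination s p.
Proof.
move=> sB Ip.
(* The first monomial of weight [d] in the support; the default is not reached when [d] is the
   weight of a support monomial. *)
pose g d := nth 0%MM (msupp p) (find (fun v => weight v == d) (msupp p)).
have wt_g u : u \in msupp p -> weight (g (weight u)) = weight u.
  move=> up; apply/eqP; apply: (@nth_find _ 0%MM (fun v => weight v == _)).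
  by apply/hasP; exists u.
have sum0 : \sum_(u <- msupp p) p@_u *: 'X_[K, g (weight u)] = 0.
  apply/mpolyP => w; rewrite mcoeff0 raddf_sum /=.
  have [gw|ne_gw] := eqVneq (g (weight w)) w.
    rewrite -[RHS](toric_ideal_sum_coeff (weight w) Ip) [RHS]big_mkcond.
    rewrite !big_seq; apply: eq_bigr => u up; rewrite mcoeffZ mcoeffX.
    have [e|ne] := eqVneq (weight u) (weight w).
      by rewrite e gw eqxx mulr1.
    case: eqP => [e|]; last by rewrite mulr0.
    by rewrite -(wt_g _ up) e eqxx in ne.
  rewrite big_seq big1 // => u up; rewrite mcoeffZ mcoeffX.
  case: eqP => [e|]; last by rewrite mulr0.
  by rewrite -[in weight w]e wt_g // e eqxx in ne_gw.
rewrite [p]mpolyE -[X in combination s X]subr0 -[X in _ - X]sum0 -sumrB.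
apply: combination_sum => u up; rewrite -scalerBr -mul_mpolyC.
by apply: combinationM; apply: sB; rewrite wt_g.
Qed.

End Toric.

(** * Finite generation by binomials of bounded degree *)

Section FiniteGeneration.
Set Implicit Arguments.
Unset Strict Implicit.
Local Open Scope ring_scope.
Variables (K : fieldType) (r : nat) (a : 'I_r -> nat) (i0 : 'I_r).
Hypothesis a_gt0 : (0 < a i0)%N.
Implicit Types (u v w : 'X_{1..r}).

Let b := a i0.

(** Exceeds the degrees [b] and [a j] in the exchange binomials, and the degrees of reduced
    monomials, which are at most [\sum_i a i + r * b]. *)
Definition binomial_bound : nat := (\sum_i a i + r * b + r * b).+1.

Definition bounded_binomials : seq {mpoly K[r]} :=
  [seq 'X_[val uv.1] - 'X_[val uv.2]
     | uv <- enum {: 'X_{1..r < binomial_bound} * 'X_{1..r < binomial_bound}}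
     & weight a (val uv.1) == weight a (val uv.2)].

Local Notation congr_mnm u v :=
  (combination bounded_binomials ('X_[K, u] - 'X_[v])).

Lemma bounded_binomials_toric p :
  p \in bounded_binomials -> toric_ideal a p.
Proof.
case/mapP => uv; rewrite mem_filter => /andP[/eqP eq_w _] ->.
exact: toric_ideal_binomial.
Qed.

Lemma congr_mnm_bounded u v :
  weight a u = weight a v -> (mdeg u < binomial_bound)%N ->
  (mdeg v < binomial_bound)%N -> congr_mnm u v.
Proof.
move=> eq_w lt_u lt_v; apply: combination_mem; apply/mapP.
exists (BMultinom lt_u, BMultinom lt_v) => //.
by rewrite mem_filter mem_enum /= eq_w eqxx.
Qed.

Lemma congr_mnm_refl u : congr_mnm u u.
Proof. by rewrite subrr; apply: combination0. Qed.

Lemma congr_mnm_sym u v : congr_mnm u v -> congr_mnm v u.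
Proof. by move=> /(combinationM (-1)); rewrite mulN1r opprB. Qed.

Lemma congr_mnm_trans v u w : congr_mnm u v -> congr_mnm v w -> congr_mnm u w.
Proof. by move=> uv /(combinationD uv); rewrite addrA subrK. Qed.

Lemma congr_mnmD w u v : congr_mnm u v -> congr_mnm (w + u)%MM (w + v)%MM.
Proof. by move=> /(combinationM 'X_[w]); rewrite mulrBr -!mpolyXD. Qed.

(* Trading x_j^b for x_{i0}^(a j), where b = a i0, keeps the weight. *)
Lemma congr_mnm_normal u :
  exists v, [/\ weight a v = weight a u, congr_mnm u v
              & forall i, i != i0 -> (v i < b)%N].
Proof.
(* Each trade lowers the total exponent of the variables other than x_{i0}. *)
have [m] := ubnP (\sum_(i | i != i0) u i); elim: m u => // m IHm u lt_m.
have [/forall_inP small|] := boolP [forall (i | i != i0), (u i < b)%N].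
  by exists u; split=> //; apply: congr_mnm_refl.
rewrite negb_forall_in => /exists_inP[j ne_j]; rewrite -leqNgt => le_b.
pose w := (u - U_(j) *+ b)%MM; pose u' := (w + U_(i0) *+ a j)%MM.
have def_u : u = (w + U_(j) *+ b)%MM.
  rewrite submK //; apply/mnm_lepP => i; rewrite mulmnE mnm1E.
  by case: eqP => [<-|]; rewrite ?mul1n ?mul0n.
have wt_j : weight a (U_(j) *+ b)%MM = weight a (U_(i0) *+ a j)%MM.
  by rewrite !weightMn !weight1 mulnC.
have le_aj : (a j <= \sum_i a i)%N by rewrite (bigD1 j) //= leq_addr.
have r_gt0 : (0 < r)%N by case: (j) => x; lia.
have le_b_rb : (b <= r * b)%N by rewrite leq_pmull.
have cong_u : congr_mnm u u'.
  rewrite def_u; apply/congr_mnmD/congr_mnm_bounded => //;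
  by rewrite mdegMn mdeg1 /binomial_bound; lia.
have [|v [wt_v cong_v small]] := IHm u'.
  rewrite -ltnS; apply: leq_trans lt_m; rewrite ltnS (bigD1 j) //= [X in (_ < X)%N](bigD1 j) //=.
  have b_gt0 : (0 < b)%N by [].
  have -> : u' j = (u j - b)%N.
    rewrite /u' /w mnmDE mnmBE !mulmnE !mnm1E eqxx.
    by rewrite eq_sym (negbTE ne_j) mul1n mul0n addn0.
  suff -> : (\sum_(i | (i != i0) && (i != j)) u' i =
             \sum_(i | (i != i0) && (i != j)) u i)%N.
    by rewrite ltn_add2r; lia.
  apply: eq_bigr => i /andP[ne_i0 ne_ij].
  rewrite /u' /w mnmDE mnmBE !mulmnE !mnm1E eq_sym (negbTE ne_ij).
  by rewrite eq_sym (negbTE ne_i0) !mul0n subn0 addn0.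
exists v; split=> //; last exact: congr_mnm_trans cong_u cong_v.
by rewrite wt_v def_u !weightD wt_j.
Qed.

Lemma congr_mnm_weight u v : weight a u = weight a v -> congr_mnm u v.
Proof.
have [u' [wt_u cong_u small_u]] := congr_mnm_normal u.
have [v' [wt_v cong_v small_v]] := congr_mnm_normal v.
rewrite -wt_u -wt_v => eq_w; apply: congr_mnm_trans cong_u _.
apply: congr_mnm_trans (congr_mnm_sym cong_v).
clear - eq_w small_u small_v a_gt0.
(* By symmetry the smaller power of x_{i0} is on the left; it divides both sides and is cancelled,
   leaving [u1] free of x_{i0}. *)
wlog le_uv : u' v' eq_w small_u small_v / (u' i0 <= v' i0)%N.
  move=> wl; case: (leqP (u' i0) (v' i0)) => [|/ltnW] le_i0; first exact: wl.
  by apply/congr_mnm_sym/wl.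
pose w := (U_(i0) *+ u' i0)%MM.
have w_i0 : w i0 = u' i0 by rewrite mulmnE mnm1E eqxx mul1n.
have w_i i : i != i0 -> w i = 0%N.
  by move=> /negbTE ne; rewrite mulmnE mnm1E eq_sym ne.
have def_u : u' = (w + (u' - w))%MM.
  rewrite addmC submK //; apply/mnm_lepP => i.
  by have [->|/w_i ->//] := eqVneq i i0; rewrite w_i0.
have def_v : v' = (w + (v' - w))%MM.
  rewrite addmC submK //; apply/mnm_lepP => i.
  by have [->|/w_i ->//] := eqVneq i i0; rewrite w_i0.
set u1 := (u' - w)%MM in def_u *; set v1 := (v' - w)%MM in def_v *.
have small_u1 i : (u1 i <= b)%N.
  rewrite mnmBE; have [->|/small_u] := eqVneq i i0; last by lia.
  by rewrite w_i0 subnn.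
have small_v1 i : i != i0 -> (v1 i <= b)%N.
  by move=> /small_v; rewrite mnmBE; lia.
have eq_w1 : weight a u1 = weight a v1.
  by move: eq_w; rewrite def_u def_v !weightD => /addnI.
have wt_u1 : (weight a u1 <= (\sum_i a i) * b)%N.
  by rewrite big_distrl; apply: leq_sum => i _; rewrite leq_mul2l small_u1 orbT.
(* The one exponent not bounded by [b] is controlled by the common weight, as x_{i0} has weight
   [b]. *)
have v1_i0 : (v1 i0 <= \sum_i a i)%N.
  rewrite -(leq_pmul2r a_gt0); apply: leq_trans wt_u1.
  by rewrite eq_w1 /weight (bigD1 i0) //= mulnC leq_addr.
rewrite def_u def_v; apply/congr_mnmD/congr_mnm_bounded => //.
  rewrite ltnS mdegE (leq_trans _ (leq_addl _ _)) // -[X in (X * b)%N]card_ord.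
  by rewrite -sum_nat_const; apply: leq_sum.
rewrite ltnS mdegE (bigD1 i0) //= (leq_trans _ (leq_addr _ _)) // leq_add //.
rewrite -[X in (X * b)%N]card_ord -sum_nat_const [X in (_ <= X)%N](bigD1 i0) //=.
by apply: leq_trans (leq_addl _ _); apply: leq_sum.
Qed.

Lemma toric_ideal_finitely_generated :
  exists s : seq {mpoly K[r]}, generates s (toric_ideal a).
Proof.
exists bounded_binomials => p; split.
  by apply: (@toric_ideal_binomial_span _ _ a) => u v; apply: congr_mnm_weight.
by apply: toric_ideal_combination => q; apply: bounded_binomials_toric.
Qed.

End FiniteGeneration.

(** * Monomials of the critical weights in four variables *)

Section Gens.
Set Implicit Arguments.
Unset Strict Implicit.

Definition mnm4 (x1 x2 x3 x4 : nat) : 'X_{1..4} :=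
  [multinom [tuple x1; x2; x3; x4]].

Lemma mnm4_eta (v : 'X_{1..4}) :
  v = mnm4 (v (inord 0)) (v (inord 1)) (v (inord 2)) (v (inord 3)).
Proof.
apply/mnmP => i; rewrite [RHS]mnm_tnth (tnth_nth 0) /=.
by case: i => -[|[|[|[|//]]]] lt_i /=; congr (v _); apply: val_inj;
  rewrite /= inordK.
Qed.

Lemma mnm4_inj x1 x2 x3 x4 y1 y2 y3 y4 :
  mnm4 x1 x2 x3 x4 = mnm4 y1 y2 y3 y4 ->
  [/\ x1 = y1, x2 = y2, x3 = y3 & x4 = y4].
Proof. by move=> /(congr1 (fun u : 'X_{1..4} => tval u)) [-> -> -> ->]. Qed.

Lemma weight_gens d n x1 x2 x3 x4 (k := 2 * n ^ (d %/ 2)) :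
  ~~ odd d -> 0 < n ->
  weight (gens d n) (mnm4 x1 x2 x3 x4) =
  x1 * (k * (k - 1)) + x2 * ((k - 1) * (k + 1)) + x3 * (k * (k + 1)) +
  x4 * (k * (k + 1) + (k - 1)).
Proof.
move=> even_d n_gt0; have m_gt0 : 0 < n ^ (d %/ 2) by rewrite expn_gt0 n_gt0.
have nd : n ^ d = n ^ (d %/ 2) * n ^ (d %/ 2).
  by rewrite -expnD addnn divn2 halfK (negbTE even_d) subn0.
rewrite /weight !big_ord_recl big_ord0 /gens !mnm_tnth !(tnth_nth 0) /= nd.
rewrite /k; move: (n ^ _) m_gt0 => m m_gt0.
(* Positivity of [m] keeps the subtractions in these factorizations from truncating. *)
have -> : 4 * (m * m) - 2 * m = 2 * m * (2 * m - 1) by nia.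
have -> : 4 * (m * m) - 1 = (2 * m - 1) * (2 * m + 1) by nia.
have -> : 4 * (m * m) + 2 * m = 2 * m * (2 * m + 1) by nia.
have -> : 4 * (m * m) + 4 * m - 1 = 2 * m * (2 * m + 1) + (2 * m - 1) by nia.
ring.
Qed.

(* With k = l + 1 the weights are (l+1)l, l(l+2), (l+1)(l+2), (l+1)(l+2) + l;
   they are 0, 0, 2, 2 modulo the odd number l, hence l divides x3 + x4. *)
Lemma weight_equation (l i x1 x2 x3 x4 : nat) :
  odd l -> i <= l ->
  x1 * (l.+1 * l) + x2 * (l * l.+2) + x3 * (l.+1 * l.+2) +
    x4 * (l.+1 * l.+2 + l) = l * (l.+1 * l.+2 + i) ->
  x3 = 0 /\ x4 = 0 \/ [/\ x1 = 0, x2 = 0, x3 = l - i & x4 = i].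
Proof.
move=> odd_l le_i eq_w.
have dvd_l : l %| x3 + x4.
  have cop : coprime l 2 by rewrite coprimen2.
  (* The quotient by [l], from (l+1)(l+2) = l(l+3) + 2. *)
  pose A := x1 * l.+1 + x2 * l.+2 + (x3 + x4) * (l + 3) + x4.
  rewrite -(Gauss_dvdl _ cop) -(@dvdn_addr (l * A)) ?dvdn_mulr //.
  suff -> : l * A + (x3 + x4) * 2 = l * (l.+1 * l.+2 + i) by rewrite dvdn_mulr.
  by rewrite -eq_w /A; ring.
(* The sum x3 + x4 is 0, [l], or at least 2l. If it is [l], cancellation leaves x1(l+1) + x2(l+2) +
   x4 = i with i <= l, which kills x1 and x2. *)
case/dvdnP: dvd_l => -[|[|q]] def_q; [left; lia | right | ].
  have l_gt0 : 0 < l by case: (l) odd_l.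
  have e : l * (x1 * l.+1 + x2 * l.+2 + x4) = l * i by nia.
  have {}e : x1 * l.+1 + x2 * l.+2 + x4 = i.
    by apply/eqP; rewrite -(eqn_pmul2l l_gt0) e.
  have x1_0 : x1 = 0.
    by case: x1 e {eq_w} => // x1; rewrite mulSn; move: (x1 * _) => y; lia.
  have x2_0 : x2 = 0.
    by case: x2 e {eq_w} => // x2; rewrite mulSn; move: (x2 * _) => y; lia.
  by rewrite x1_0 x2_0 in e *; split; lia.
(* The weight would be at least 2l(l+1)(l+2), too much because i < (l+1)(l+2). *)
exfalso; have l_gt0 : 0 < l by case: (l) odd_l.
have lb : 2 * l * (l.+1 * l.+2) <= (x3 + x4) * (l.+1 * l.+2).
  by apply: leq_mul => //; rewrite def_q leq_mul2r orbT.
have ub : (x3 + x4) * (l.+1 * l.+2) <= l * (l.+1 * l.+2 + i).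
  by rewrite -eq_w mulnDl mulnDr; lia.
have lt_i : l * i < l * (l.+1 * l.+2).
  by rewrite ltn_pmul2l // (leq_ltn_trans le_i) // leq_pmulr.
by move: lb ub lt_i; rewrite mulnDr -mulnA; lia.
Qed.

End Gens.

(** * Isolated monomials and their dual binomials for the given family *)

Theorem theorem5p4 (d : nat) (hd : 2 <= d) (hd_even : ~~ odd d)
    (n : nat) (hn : 1 <= n) (K : fieldType) :
  2 * n ^ (d %/ 2) <= beta1 K (gens d n).
Proof.
have wtE x1 x2 x3 x4 := weight_gens x1 x2 x3 x4 hd_even hn.
move: wtE; have : 0 < n ^ (d %/ 2) by rewrite expn_gt0 hn.
move: (n ^ (d %/ 2)) (gens d n) => m a m_gt0 wtE.
pose l := (2 * m).-1; have odd_l : odd l by rewrite /l; lia.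
have k_l : 2 * m = l.+1 by rewrite /l; lia.
rewrite k_l in wtE *; clearbody l; clear m m_gt0 k_l.
have {}wtE x1 x2 x3 x4 : weight a (mnm4 x1 x2 x3 x4) =
    x1 * (l.+1 * l) + x2 * (l * l.+2) + x3 * (l.+1 * l.+2) +
    x4 * (l.+1 * l.+2 + l).
  by rewrite wtE subn1 addn1.
pose u (i : 'I_l.+1) := mnm4 0 0 (l - i) i.
pose w (i : 'I_l.+1) := mnm4 (l.+2 - i) i 0 0.
have wt_u i : weight a (u i) = l * (l.+1 * l.+2 + i).
  by rewrite wtE; have := ltn_ord i; nia.
have wt_w i : weight a (w i) = l * (l.+1 * l.+2 + i).
  by rewrite wtE; have := ltn_ord i; nia.
apply: leq_min_gens.
  apply: (@toric_ideal_finitely_generated _ _ _ ord0).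
  rewrite -weight1 (_ : U_(ord0)%MM = mnm4 1 0 0 0) ?wtE; first by nia.
  apply/mnmP => i; rewrite mnm1E [RHS]mnm_tnth (tnth_nth 0).
  by case: i => -[|[|[|[|//]]]].
pose f (j : 'I_l.+1) := ('X_[K, u j] - 'X_[w j])%R.
move=> s; apply: (@isolated_leq_size _ _ _ _ u f).
- move=> i v; rewrite wt_u [v]mnm4_eta; set x1 := v _; set x2 := v _.
  set x3 := v _; set x4 := v _; rewrite wtE => eq_w.
  have le_i : i <= l by rewrite -ltnS.
  (* Another monomial of this weight involves only x1 and x2, whereas [u i] involves only x3 and
     x4. *)
  case: (weight_equation odd_l le_i eq_w) => [[-> ->] _ j|[-> -> -> -> //]].
  rewrite !mnm_tnth !(tnth_nth 0).
  by case: j => -[|[|[|[|//]]]] /= _; [right | right | left | left].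
- by move=> j; apply: toric_ideal_binomial; rewrite wt_u wt_w.
move=> i j; rewrite /f mcoeffB !mcoeffX.
(* The exponent of x1 is positive in [w j] and zero in [u i]. *)
have -> : (w j == u i) = false.
  by apply/eqP => /mnm4_inj[]; have := ltn_ord j; lia.
rewrite subr0 (eq_sym i); congr (_%:R)%R; congr nat_of_bool.
apply/eqP/eqP => [/mnm4_inj[_ _ _ e]|->//]; exact: val_inj.
Qed.
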